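(* The set $\mathcal{NH}$ of all nowhere Hölder functions, i.e. continuous functions $F:[0,1]\to\mathbb{R}$ such that for every $x\in[0,1]$ and every $\alpha\in(0,1]$ $$\limsup_{y\to x}\frac{|F(x)-F(y)|}{|x-y|^\alpha}=\infty,$$ is strongly $\mathfrak{c}$-algebrable (as a subset of the algebra $\mathbb{R}^{[0,1]}$).
   Context: $\mathfrak{c}=2^{\omega}$ is the cardinality of the continuum. $\mathbb{R}^{[0,1]}$ is the real commutative algebra of all functions $[0,1]\to\mathbb{R}$ with pointwise operations. A subset $S$ of a commutative real algebra $\mathcal{L}$ is strongly $\kappa$-algebrable if $S\cup\{0\}$ contains a $\kappa$-generated algebra isomorphic to a free (commutative, non-unital) algebra; equivalently, there is a set $X\subseteq\mathcal{L}$ of cardinality $\kappa$ such that for every $k\ge 1$, every nonzero real polynomial $P$ in $k$ variables without constant term and all distinct $y_1,\dots,y_k\in X$, we have $P(y_1,\dots,y_k)\neq 0$ and $P(y_1,\dots,y_k)\in S$. *)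

(* Defs.v *)
From HB Require Import structures.
From mathcomp Require Import all_boot all_order all_algebra.
From mathcomp Require Import all_classical all_reals all_analysis.
(* The notations of mpoly clash with those of the analysis library.
   [mpoly k R] is {mpoly R[k]}. *)
From mathcomp Require Import -(notations) mpoly.

Set Implicit Arguments.
Unset Strict Implicit.
Unset Printing Implicit Defensive.

Import Order.TTheory GRing.Theory Num.Theory.
Import numFieldNormedType.Exports.

Local Open Scope classical_set_scope.
Local Open Scope card_scope.
Local Open Scope ring_scope.

(* [0, 1] as a type, with the topology induced by that of R. *)
Definition unit_interval (R : realType) : Type :=
  set_type (`[0, 1]%classic : set R).

Definition unit_val (R : realType) (x : unit_interval R) : R := set_val x.

Lemma unit_interval_mem0 (R : realType) :
  (0 : R) \in (`[0, 1]%classic : set R).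
Proof. by rewrite inE /= in_itv /= lexx ler01. Qed.

HB.instance Definition _ (R : realType) :=
  PseudoMetric.copy (unit_interval R) (set_type (`[0, 1]%classic : set R)).

HB.instance Definition _ (R : realType) :=
  isPointed.Build (unit_interval R)
    (exist _ (0 : R) (unit_interval_mem0 R) : unit_interval R).

(* The pointwise ring and R-module structures on [T -> R] come from the
   library; only their compatibility is missing there.  [T] is pointed because
   the library's algebras are nontrivial rings. *)
Section FunctionAlgebra.
Context (T : pointedType) (R : realType).

Let fct_scalerAl (a : R) (f g : T -> R) : a *: (f * g) = a *: f * g.
Proof. by apply/funext => x; exact: mulrA. Qed.

HB.instance Definition _ :=
  GRing.Lmodule_isLalgebra.Build R (T -> R) fct_scalerAl.

HB.instance Definition _ := GRing.Lalgebra_isComAlgebra.Build R (T -> R).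

End FunctionAlgebra.

(* P(y_1, ..., y_k) for y_1, ..., y_k in an R-algebra. *)
Definition mpoly_eval (R : realType) (L : comAlgType R) (k : nat)
    (y : 'I_k -> L) (P : mpoly k R) : L :=
  mmap (in_alg L) y P.

(* The cardinal kappa is represented by a set [kappa] of that cardinality. *)
Definition strongly_algebrable (R : realType) (L : comAlgType R) (K : Type)
    (kappa : set K) (S : set L) : Prop :=
  exists X : set L, X #= kappa /\
    forall (k : nat) (P : mpoly k R) (y : 'I_k -> L),
      (0 < k)%N -> P != 0 -> mcoeff (@mnm0 k) P = 0 ->
      injective y -> (forall i, X (y i)) ->
      mpoly_eval y P != 0 /\ S (mpoly_eval y P).

Definition continuum : set (nat -> bool) := [set: nat -> bool].

(* The limsup is over y in [0, 1] with y != x: [x^'] is the filter of punctured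
   neighbourhoods of x in the subspace [0, 1]. *)
Definition nowhere_holder (R : realType) : set (unit_interval R -> R) :=
  [set F | continuous F /\
    forall (x : unit_interval R) (alpha : R), 0 < alpha <= 1 ->
      limf_esup (fun y : unit_interval R =>
        (`|F x - F y| / `|unit_val x - unit_val y| `^ alpha)%:E) x^' = +oo%E].

(* Main.v *)
Require Import Defs.
From mathcomp Require Import all_boot all_order all_algebra.
From mathcomp Require Import all_classical all_reals all_analysis.
From mathcomp Require Import -(notations) mpoly.
From mathcomp Require Import ring lra zify.

(** The proof composes exponentials with a single function. Fix a nowhere
    Hölder function F and reals beta_s, indexed by binary sequences s, that are
    linearly independent over the integers; the generators are the functions
    exp (beta_s F).

    Evaluating a nonzero polynomial P without constant term at distinct
    generators gives f o F with f t = sum_m P_m exp (lambda_m t), where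
    lambda_m = sum_i m_i beta_(s_i). Independence makes the exponents lambda_m
    pairwise distinct, and nonzero because m = 0 does not occur in P. Such an f
    is flat to finite order only: near every t it satisfies
    |f t - f t'| >= c |t - t'|^n for some n > 0 and c > 0
    ([exp_sum_local_growth]). Hence the oscillation of f o F at the exponent
    alpha is bounded below by c times the n-th power of the oscillation of F at
    the exponent alpha / n. Since F is not Hölder at any point for any positive
    exponent, neither is f o F ([wildly_oscillating_comp]). In particular f o F
    is not zero, so the generators are algebraically independent.

    The function F is the lacunary series sum_n 8^-n cos (pi b_n x) with
    b_n = 8^(4 n^2). Within 1 / b_n of any point, the n-th term can be
    made to vary by 8^-n, the earlier terms are too slow to cancel that, and the
    later ones too small; and 8^-n beats b_n^-alpha for every alpha > 0
    ([lacunary_oscillating]).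

    The reals beta_s have binary expansions whose digits sit in the squares of
    the elements of an almost disjoint family of infinite sets of integers, one
    set for each s ([branch_real_indep]). *)

Set Implicit Arguments.
Unset Strict Implicit.
Unset Printing Implicit Defensive.

Import Order.TTheory GRing.Theory Num.Theory.
Import numFieldNormedType.Exports.

Local Open Scope classical_set_scope.
Local Open Scope ring_scope.

(** * Series dominated by a geometric one *)

Lemma dominated_series_cvg (R : realType) (u : R^nat) (M : R) :
  (forall n, `|u n| <= M / 2 ^+ n) -> cvgn (series u).
Proof.
move=> uM; apply: normed_cvg.
apply: (@series_le_cvg _ _ (geometric M 2^-1)) => [n|n|n|] /=.
- exact: normr_ge0.
- by rewrite exprVn; exact: le_trans (uM n).
- by rewrite exprVn.
- apply: is_cvg_geometric_series.
  by rewrite ger0_norm ?invr_ge0// invf_lt1 // ltr1n.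
Qed.

Lemma series_tail_le (R : realType) (u : R^nat) (M : R) (n : nat) :
  cvgn (series u) -> (forall j, `|u (n + j)%N| <= M / 2 ^+ j) ->
  `|limn (series u) - series u n| <= 2 * M.
Proof.
move=> cu uM.
have M0 : 0 <= M by have := uM 0%N; rewrite expr0 divr1; exact: le_trans.
have part p : `|series u (n + p)%N - series u n| <= 2 * M * (1 - (2 ^+ p)^-1).
  elim: p => [|p IHp]; first by rewrite addn0 subrr normr0 expr0 invr1 subrr mulr0.
  rewrite addnS /series /= big_nat_recr //= -/(series u _).
  have -> : \sum_(0 <= k < n + p) u k + u (n + p)%N - \sum_(0 <= k < n) u k =
    (series u (n + p)%N - series u n) + u (n + p)%N by rewrite /series /=; ring.
  apply: le_trans (ler_normD _ _) _.
  apply: le_trans (lerD IHp (uM p)) _.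
  rewrite exprS invfM; set q := (2 ^+ p)^-1; lra.
have cn : (fun k => `|series u k - series u n|) @ \oo -->
    `|limn (series u) - series u n|.
  by apply: cvg_norm; apply: cvgB => //; exact: cvg_cst.
(* The bound holds for all partial sums past [n], hence for their limit. *)
rewrite -(cvg_lim (@Rhausdorff _) cn); apply: limr_le.
  by apply/cvg_ex; eexists; exact: cn.
near=> k.
have nk : (n <= k)%N by near: k; exact: nbhs_infty_ge.
rewrite -(subnKC nk); apply: le_trans (part _) _.
rewrite ler_piMr ?mulr_ge0// lerBlDr lerDl invr_ge0; exact: exprn_ge0.
Unshelve. all: by end_near. Qed.

(** * A continuum of reals independent over the integers *)

(** The first [n] bits of [s] read as a binary number after a leading 1; the
    leading 1 makes the code determine the length [n] as well. *)
Fixpoint prefix_code (s : nat -> bool) (n : nat) : nat :=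
  if n is m.+1 then (prefix_code s m).*2 + s m else 1.

Lemma prefix_code_gt (s : nat -> bool) n : (n < prefix_code s n)%N.
Proof. by elim: n => //= n IHn; lia. Qed.

Lemma prefix_code_inj (s t : nat -> bool) n n' :
  prefix_code s n = prefix_code t n' ->
  n = n' /\ forall i, (i < n)%N -> s i = t i.
Proof.
elim: n n' => [|n IHn] [|n'] //=.
- by have := prefix_code_gt t n'; lia.
- by have := prefix_code_gt s n; lia.
move=> e; have e1 : prefix_code s n = prefix_code t n' by lia.
have e2 : s n = t n' by move: e; rewrite e1; case: (s n) (t n') => [] []; lia.
have [<- H] := IHn _ e1; split=> // i; rewrite ltnS leq_eqVlt => /orP[/eqP->|/H//].
by rewrite e2; have [->] := IHn _ e1.
Qed.

(** The set of codes of the finite prefixes of [s], that is, a branch of the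
    binary tree. The bound [n < k] makes membership decidable; it loses nothing
    by [prefix_code_gt]. *)
Definition branch (s : nat -> bool) (k : nat) : bool :=
  [exists n : 'I_k, prefix_code s n == k]%B.

Lemma branch_code s n : branch s (prefix_code s n).
Proof. by apply/existsP; exists (Ordinal (prefix_code_gt s n)); exact: eqxx. Qed.

(** Prefixes of [s] that reach past its first disagreement with [t] are not
    prefixes of [t]: the branches are almost disjoint. *)
Lemma branch_disjoint (s t : nat -> bool) : s <> t ->
  exists N, forall n, (N <= n)%N -> branch t (prefix_code s n) = false.
Proof.
move=> st; have [d dP] : exists d, s d <> t d.
  by apply/existsNP => H; apply: st; apply/funext.
exists d.+1 => n dn; apply/negbTE/negP => /existsP[i /eqP/esym/prefix_code_inj[_ Hi]].
exact: dP (Hi _ dn).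
Qed.

Section IndependentReals.
Variable R : realType.

(** The exponents [k ^ 2] have gaps that tend to infinity; this is what the
    integrality argument of [branch_real_indep] uses. *)
Definition weight (k : nat) : R := (2 ^+ (k ^ 2))^-1.

Definition branch_real (s : nat -> bool) : R :=
  limn (series (fun k => (branch s k)%:R * weight k)).

Lemma weight_gt0 k : 0 < weight k.
Proof. by rewrite invr_gt0 exprn_gt0. Qed.

Lemma weightD n j : weight (n + j) <= weight n / 2 ^+ j.
Proof.
rewrite /weight -invfM -exprD lef_pV2 ?posrE ?exprn_gt0//.
rewrite ler_eXn2l ?ltr1n//; nia.
Qed.

Lemma branch_real_approx s n :
  `|branch_real s - series (fun k => (branch s k)%:R * weight k) n|
    <= 2 * weight n.
Proof.
have H m j : `|(branch s (m + j))%:R * weight (m + j)| <= weight m / 2 ^+ j.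
  rewrite normrM (gtr0_norm (weight_gt0 _)); apply: le_trans (weightD m j).
  rewrite ler_piMl ?(ltW (weight_gt0 _))//.
  by case: (branch _ _); rewrite ?normr1 ?normr0.
by apply: series_tail_le (H n); apply: (@dominated_series_cvg _ _ (weight 0)) => k; exact: (H 0%N).
Qed.

(** A vanishing integer combination gives a series sum_k d_k 2^-(k^2) = 0 with
    bounded integer digits d_k. Its partial sum up to the index n, scaled by
    2^(n^2), is an integer and tends to 0 because the gaps of the exponents
    grow; so it is 0 for large n, and the digits vanish from some index on. But
    d_k = c_i for the infinitely many k that lie on the branch of [s i] and on
    no other one. *)
Lemma branch_real_indep (I : finType) (s : I -> nat -> bool) (c : I -> int) :
  injective s -> \sum_i (c i)%:~R * branch_real (s i) = 0 ->
  forall i, c i = 0.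
Proof.
move=> sI c0.
pose d k : int := \sum_i c i * (branch (s i) k)%:R.
pose S n : R := \sum_(0 <= k < n) (d k)%:~R * weight k.
pose C : R := \sum_i `|(c i)%:~R|.
have SE n : S n = \sum_i (c i)%:~R *
    series (fun k => (branch (s i) k)%:R * weight k) n.
  rewrite /S /series /=.
  under [RHS]eq_bigr do rewrite mulr_sumr.
  rewrite [RHS]exchange_big; apply: eq_bigr => k _ /=.
  rewrite /d rmorph_sum /= mulr_suml; apply: eq_bigr => i _.
  by rewrite rmorphM /= mulrA; case: (branch _ _).
have Ssmall n : `|S n| <= C * (2 * weight n).
  rewrite SE -normrN -[- _](addr0) -{2}c0 addrC -sumrB.
  apply: le_trans (ler_norm_sum _ _ _) _; rewrite /C mulr_suml.
  apply: ler_sum => i _; rewrite -mulrBr normrM ler_wpM2l//.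
  exact: branch_real_approx.
have Sint n : S n.+1 * 2 ^+ (n ^ 2) \is a Num.int.
  rewrite /S mulr_suml big_nat; apply: rpred_sum => k /andP[_ kn].
  rewrite -mulrA; apply: rpredM; first exact: intr_int.
  have -> : weight k * 2 ^+ (n ^ 2) = 2 ^+ (n ^ 2 - k ^ 2) :> R.
    rewrite /weight mulrC -expfB_cond// ?leq_sqr//.
    by rewrite pnatr_eq0 /= leq_sqr.
  by rewrite -natrX rpred_nat.
have [N NC] : exists N : nat, C * 2 < N%:R.
  exists (Num.truncn (C * 2)).+1; apply: truncnS_gt.
have S0 n : (N <= n)%N -> S n.+1 = 0.
  move=> Nn; have : `|S n.+1 * 2 ^+ (n ^ 2)| < 1.
    rewrite normrM [X in _ * X]ger0_norm ?exprn_ge0//.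
    apply: le_lt_trans (ler_wpM2r _ (Ssmall _)) _; first exact: exprn_ge0.
    rewrite /weight.
    have -> : (n.+1 ^ 2 = n.*2.+1 + n ^ 2)%N by lia.
    rewrite exprD invfM -!mulrA mulVf ?expf_neq0 ?pnatr_eq0// mulr1 mulrA.
    rewrite ltr_pdivrMr ?exprn_gt0// mul1r.
    apply: lt_trans NC _; rewrite -natrX ltr_nat.
    by apply: leq_ltn_trans (ltn_expl _ _) => //; lia.
  have /intrP[z zE] := Sint n; rewrite zE -intr_norm ltrz1 => z1.
  have z0 : z = 0 by lia.
  move/eqP: zE; rewrite z0 mulf_eq0 expf_eq0 pnatr_eq0 andbF orbF.
  by move/eqP.
have d0 k : (N < k)%N -> d k = 0.
  move=> Nk; have := S0 k (ltnW Nk).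
  rewrite /S big_nat_recr //= -/(S k).
  have -> : S k = 0 by case: k Nk => // k Nk; exact: S0.
  rewrite add0r => /eqP; rewrite mulf_eq0 (gt_eqF (weight_gt0 _)) orbF.
  by rewrite intr_eq0 => /eqP.
move=> i.
(* [D] is a length from which the prefixes of [s i] avoid all other branches. *)
have [D DP] : exists D, forall j n, j != i -> (D <= n)%N ->
    branch (s j) (prefix_code (s i) n) = false.
  have H (j : I) : exists N, forall n, j != i -> (N <= n)%N ->
      branch (s j) (prefix_code (s i) n) = false.
    have [->|ji] := eqVneq j i; first by exists 0%N.
    have sij : s i <> s j by move=> /sI ij; rewrite ij eqxx in ji.
    have [M MP] := branch_disjoint sij.
    by exists M => n _; exact: MP.
  have [g gP] := choice H.
  exists (\max_j g j) => j n ji Dn; apply: gP => //.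
  by apply: leq_trans Dn; exact: leq_bigmax.
have := d0 (prefix_code (s i) (maxn D N)).
rewrite /d (bigD1 i) //= branch_code mulr1 big1 ?addr0; first by apply; apply: leq_ltn_trans (prefix_code_gt _ _); exact: leq_maxr.
by move=> j ji; rewrite DP ?mulr0// leq_maxl.
Qed.

End IndependentReals.

(** * Exponential sums are nowhere flat *)

Section ExponentialTaylor.
Variable R : realType.

Definition exp_rem (n : nat) (x : R) : R :=
  expR x - \sum_(j < n) x ^+ j / j`!%:R.

Lemma exp_rem_derive n (x : R) : is_derive x 1 (exp_rem n.+1) (exp_rem n x).
Proof.
have H (j : nat) : is_derive x 1 (fun y : R => y ^+ j.+1 / j.+1`!%:R)
    (x ^+ j / j`!%:R).
  have -> : (fun y : R => y ^+ j.+1 / j.+1`!%:R) =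
      j.+1`!%:R^-1 \*: (id ^+ j.+1 : R -> R).
    by apply/funext => y; rewrite /= !fctE mulrC.
  apply: is_derive_eq.
  rewrite /GRing.scale /= mulr1 factS natrM; field.
  by rewrite pnatr_eq0 -lt0n fact_gt0 nat1r pnatr_eq0.
rewrite (_ : exp_rem n.+1 = expR - (cst 1 +
    \sum_(j < n) (fun y : R => y ^+ j.+1 / j.+1`!%:R))); last first.
  apply/funext => y; rewrite /exp_rem big_ord_recl /= expr0 fact0 divr1.
  by rewrite !fctE fct_sumE.
rewrite (_ : exp_rem n x = expR x - (0 + \sum_(j < n) x ^+ j / j`!%:R)); last by rewrite add0r.
apply: is_deriveB.
Qed.

(** Induction on [n] by the mean value theorem, as the derivative of each
    remainder is the previous one. *)
Lemma exp_rem_le n (x : R) : `|exp_rem n x| <= `|x| ^+ n * expR `|x|.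
Proof.
elim: n x => [|n IHn] x.
  rewrite /exp_rem big_ord0 subr0 expr0 mul1r ger0_norm ?expR_ge0// ler_expR.
  exact: ler_norm.
have r0 : exp_rem n.+1 0 = 0.
  rewrite /exp_rem big_ord_recl expR0 /= expr0 fact0 divr1 big1 ?addr0 ?subrr//.
  by move=> i _; rewrite expr0n /= mul0r.
have cr (a b : R) : {within `[a, b], continuous (exp_rem n.+1)}.
  apply: continuous_subspaceT => y; apply: differentiable_continuous.
  by apply/derivable1_diffP; have [] := exp_rem_derive n y.
have [c cx ->] : exists2 c, `|c| <= `|x| & exp_rem n.+1 x = exp_rem n c * x.
  have [x0|x0] := leP 0 x.
    have [c] := MVT_segment x0 (fun y _ => exp_rem_derive n y) (cr _ _).
    rewrite r0 !subr0 in_itv /= => /andP[c0 cx] e; exists c => //.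
    by rewrite !ger0_norm.
  have [c] := MVT_segment (ltW x0) (fun y _ => exp_rem_derive n y) (cr _ _).
  rewrite r0 !sub0r in_itv /= => /andP[c0 cx] e; exists c.
    by rewrite !ler0_norm ?lerN2// ltW.
  by apply: oppr_inj; rewrite e mulrN.
rewrite normrM exprSr -mulrA [`|x| * _]mulrC mulrA ler_wpM2r//.
apply: le_trans (IHn c) _; apply: ler_pM; rewrite ?exprn_ge0 ?expR_ge0//.
  by rewrite lerXn2r ?nnegrE.
by rewrite ler_expR.
Qed.

End ExponentialTaylor.

Section ExponentialSums.
Variable R : realType.

(** A Vandermonde argument: if all moments of positive order vanished, then so
    would sum_i b_i q(lam_i) for every polynomial [q] with [q.[0] = 0], in
    particular for one that vanishes at all [lam i] but one. *)
Lemma moment_neq0 (I : eqType) (r : seq I) (b lam : I -> R) :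
  uniq r -> r != [::] -> (forall i, i \in r -> b i != 0) ->
  {in r &, injective lam} -> (forall i, i \in r -> lam i != 0) ->
  exists2 n, (0 < n)%N & \sum_(i <- r) b i * lam i ^+ n != 0.
Proof.
case: r => // i0 r /=/andP[i0r ur] _ b0 lamI lam0.
pose q : {poly R} := 'X * \prod_(j <- r) ('X - (lam j)%:P).
have q0 : q`_0 = 0 by rewrite coefXM.
have qr i : i \in r -> q.[lam i] = 0.
  move=> ir; rewrite hornerM horner_prod (big_rem i ir) /=.
  by rewrite hornerXsubC subrr mul0r mulr0.
have qi0 : q.[lam i0] != 0.
  rewrite hornerM hornerX mulf_neq0 ?lam0 ?mem_head// horner_prod.
  rewrite prodf_seq_neq0; apply/allP => j jr /=.
  rewrite hornerXsubC subr_eq0; apply: contra i0r => /eqP /lamI ->//.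
    exact: mem_head.
  by rewrite inE jr orbT.
apply: contrapT => H.
have : \sum_(i <- i0 :: r) b i * q.[lam i] = 0.
  under eq_bigr do rewrite horner_coef mulr_sumr.
  rewrite exchange_big /= big1 // => -[[|n] /= nq] _.
    by rewrite big1 // => i _; rewrite q0 mul0r mulr0.
  under eq_bigr do rewrite mulrCA.
  rewrite -mulr_sumr; apply/eqP; rewrite mulf_eq0; apply/orP; right.
  by apply: contrapT => /negP ?; apply: H; exists n.+1.
rewrite big_cons [X in _ + X]big_seq big1 => [|i /qr ->]; last exact: mulr0.
by rewrite addr0; apply/eqP; rewrite mulf_neq0 // b0 ?mem_head.
Qed.

(** Up to positive factors, the Taylor coefficients of [f] at [t] of order
    n > 0 are the moments sum_i b_i lam_i^n with b_i = a_i exp (lam_i t). The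
    first one that does not vanish dominates the variation of [f] near [t]. *)
Lemma exp_sum_local_growth (I : eqType) (r : seq I) (a lam : I -> R) (t : R) :
  uniq r -> r != [::] -> (forall i, i \in r -> a i != 0) ->
  {in r &, injective lam} -> (forall i, i \in r -> lam i != 0) ->
  let f t := \sum_(i <- r) a i * expR (lam i * t) in
  exists2 n, (0 < n)%N & exists2 c : R, 0 < c & exists2 e : R, 0 < e &
    forall t', `|t - t'| < e -> c * `|t - t'| ^+ n <= `|f t - f t'|.
Proof.
move=> ur r0 a0 lamI lam0 f.
pose b i := a i * expR (lam i * t).
have [|n0 n0p n0P] := @moment_neq0 I r b lam ur r0 _ lamI lam0.
  by move=> i ir; rewrite mulf_neq0 ?a0// gt_eqF ?expR_gt0.
pose m n := \sum_(i <- r) b i * lam i ^+ n.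
have ex : exists n, (0 < n)%N && (m n != 0) by exists n0; rewrite n0p.
case: (ex_minnP ex) => n /andP[np mn] nmin.
have mlt j : (0 < j < n)%N -> m j = 0.
  move=> /andP[j0 jn]; apply/eqP; apply/negPn/negP => mj.
  by have := nmin j; rewrite j0 mj => /(_ isT); rewrite leqNgt jn.
pose K := \sum_(i <- r) `|b i| * (`|lam i| ^+ n.+1 * expR `|lam i|).
(* The Taylor terms of order between 1 and [n - 1] vanish by minimality of [n]. *)
have expand h : f (t + h) - f t =
    m n / n`!%:R * h ^+ n + \sum_(i <- r) b i * exp_rem n.+1 (lam i * h).
  have -> : f (t + h) - f t = \sum_(i <- r) b i * (expR (lam i * h) - 1).
    rewrite /f -sumrB; apply: eq_bigr => i _.
    by rewrite mulrDr expRD /b; ring.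
  apply/eqP; rewrite -subr_eq -sumrB; apply/eqP.
  transitivity (\sum_(i <- r) \sum_(1 <= j < n.+1) b i * lam i ^+ j * (h ^+ j / j`!%:R)).
    apply: eq_bigr => i _.
    rewrite /exp_rem -(big_mkord xpredT (fun j => (lam i * h) ^+ j / j`!%:R)).
    rewrite big_ltn // expr0 fact0 divr1 -mulrBr.
    rewrite [X in b i * X](_ : _ = \sum_(1 <= j < n.+1) (lam i * h) ^+ j / j`!%:R); last by ring.
    by rewrite mulr_sumr; apply: eq_bigr => j _; rewrite exprMn; ring.
  rewrite exchange_big /= big_nat_recr //= -mulr_suml -/(m n) big_nat big1 ?add0r.
    by rewrite mulrA mulrAC.
  by move=> j jn; rewrite -mulr_suml -/(m j) mlt ?mul0r.
have rem h : `|h| <= 1 ->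
    `|\sum_(i <- r) b i * exp_rem n.+1 (lam i * h)| <= K * `|h| ^+ n.+1.
  move=> h1; apply: le_trans (ler_norm_sum _ _ _) _.
  rewrite /K mulr_suml; apply: ler_sum => i _.
  rewrite normrM -mulrA ler_wpM2l//; apply: le_trans (exp_rem_le _ _) _.
  rewrite normrM exprMn mulrAC ler_wpM2r ?exprn_ge0// ler_wpM2l ?exprn_ge0//.
  by rewrite ler_expR ler_piMr.
pose A := `|m n| / n`!%:R.
have A0 : 0 < A by rewrite divr_gt0 ?normr_gt0// ltr0n fact_gt0.
have K0 : 0 <= K.
  by apply: sumr_ge0 => i _; rewrite !mulr_ge0 ?exprn_ge0 ?expR_ge0.
exists n => //; exists (A / 2); first by rewrite divr_gt0.
(* This radius keeps the remainder below half of the leading term. *)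
exists (Num.min 1 (A / (2 * (K + 1)))).
  by rewrite lt_min ltr01 divr_gt0// mulr_gt0// ltr_wpDl.
move=> t'; rewrite lt_min distrC => /andP[h1 hA].
rewrite [X in _ <= X]distrC -{2}(subrKC t t'); move: (t' - t) h1 hA => h h1 hA.
rewrite expand.
apply: le_trans (lerB_normD _ _).
apply: le_trans (lerB (lexx _) (rem h (ltW h1))).
rewrite normrM normrX normrM normfV [`|n`!%:R|]ger0_norm// -/A exprSr.
have hK : K * `|h| <= A / 2.
  have : `|h| * (2 * (K + 1)) <= A.
    by rewrite -ler_pdivlMr ?ltW// mulr_gt0// ltr_wpDl.
  have := normr_ge0 h; move: (`|h|) => y; nra.
have : 0 <= `|h| ^+ n by rewrite exprn_ge0.
move: (`|h| ^+ n) (`|h|) hK => z y; nra.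
Qed.

Lemma exp_sum_continuous (I : Type) (r : seq I) (a lam : I -> R) :
  continuous (fun t => \sum_(i <- r) a i * expR (lam i * t)).
Proof.
move=> t; elim: r => [|i r IHr].
  by under eq_fun do rewrite big_nil; exact: cvg_cst.
rewrite (_ : (fun t => _) = (fun t => a i * expR (lam i * t)) \+
  (fun t => \sum_(i <- r) a i * expR (lam i * t))); last first.
  by apply/funext => u; rewrite big_cons.
apply: continuousD => //; apply: cvgMr; apply: continuous_comp.
  by apply: cvgMr; exact: cvg_id.
exact: continuous_expR.
Qed.

End ExponentialSums.

(** * Oscillation at every scale *)

Section NowhereHolder.
Variable R : realType.

(** The condition on the upper limits in the definition of nowhere Hölder
    functions, unfolded into inequalities free of division. *)
Definition wildly_oscillating (F : unit_interval R -> R) : Prop :=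
  forall x (alpha e M : R), 0 < alpha <= 1 -> 0 < e -> 0 < M ->
    exists y, [/\ unit_val x != unit_val y, `|unit_val x - unit_val y| < e &
      M * `|unit_val x - unit_val y| `^ alpha <= `|F x - F y|].

Lemma unit_ball (x : unit_interval R) (e : R) :
  ball x e = [set y | `|unit_val x - unit_val y| < e].
Proof. by []. Qed.

Lemma wildly_oscillating_nowhere_holder (F : unit_interval R -> R) :
  continuous F -> wildly_oscillating F -> nowhere_holder F.
Proof.
move=> cF wF; split=> // x alpha a01.
rewrite limf_esupE; apply/ereal_inf_pinfty => _ [V /= xV <-].
have /nbhs_ballP[e /= e0 eV] : nbhs x (fun y => y != x -> V y) by [].
apply/eqyP => M M0; have [y [xy ye yM]] := wF x _ _ _ a01 e0 M0.
have u0 : 0 < `|unit_val x - unit_val y| `^ alpha.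
  by rewrite powR_gt0// normr_gt0 subr_eq0.
apply: le_trans (ereal_sup_ubound _); last first.
  exists y; last by [].
  by apply: eV => //; apply: contra_neq xy => ->.
by rewrite lee_fin ler_pdivlMr.
Qed.

Lemma wildly_oscillating_neq0 (F : unit_interval R -> R) :
  wildly_oscillating F -> F != 0.
Proof.
move=> wF; apply/eqP => F0.
have [y [xy _]] := wF point 1 1 1 (introT andP (conj ltr01 (lexx 1))) ltr01 ltr01.
have Fz z : F z = 0 by rewrite F0.
rewrite !Fz subrr normr0 mul1r leNgt powR_gt0//.
by rewrite normr_gt0 subr_eq0.
Qed.

(** The exponent [alpha] for [f \o F] is paid for by the exponent
    [alpha / n] for [F], where [n] is the order of [f] at [F x]. *)
Lemma wildly_oscillating_comp (F : unit_interval R -> R) (f : R -> R) :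
  continuous F -> wildly_oscillating F ->
  (forall t, exists2 n, (0 < n)%N & exists2 c : R, 0 < c & exists2 e : R, 0 < e &
    forall t', `|t - t'| < e -> c * `|t - t'| ^+ n <= `|f t - f t'|) ->
  wildly_oscillating (f \o F).
Proof.
move=> cF wF gf x alpha e M /andP[a0 a1] e0 M0.
have [n n0 [c c0 [d d0 fP]]] := gf (F x).
have /nbhs_ballP[e' /= e'0 e'P] : nbhs x (F @^-1` ball (F x) d).
  by apply: cF; exact: nbhsx_ballx.
have nR : 0 < n%:R :> R by rewrite ltr0n.
have an : 0 < alpha / n%:R <= 1.
  rewrite divr_gt0//= ler_pdivrMr// mul1r; apply: le_trans a1 _.
  by rewrite ler1n.
(* As [M' >= 1], its [n]-th power still exceeds [M / c]. *)
pose M' := Num.max 1 (M / c).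
have M'0 : 0 < M' by rewrite lt_max ltr01.
have e''0 : 0 < Num.min e e' by rewrite lt_min e0.
have [y [xy]] := wF x _ _ _ an e''0 M'0.
rewrite lt_min => /andP[ye ye'] yM; exists y; split=> //=.
apply: le_trans (fP _ _); last exact: (e'P y).
set u := `|unit_val x - unit_val y|.
have -> : u `^ alpha = (u `^ (alpha / n%:R)) ^+ n.
  by rewrite -powR_mulrn ?powR_ge0// -powRrM mulfVK// gt_eqF.
have H : (M' * u `^ (alpha / n%:R)) ^+ n <= `|F x - F y| ^+ n.
  by rewrite lerXn2r ?nnegrE ?mulr_ge0 ?powR_ge0 ?(ltW M'0).
rewrite -ler_pdivrMl//; apply: le_trans H; rewrite exprMn mulrA.
rewrite ler_wpM2r ?exprn_ge0 ?powR_ge0//.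
rewrite mulrC; apply: (@le_trans _ _ M'); first by rewrite le_max lexx orbT.
by rewrite ler_eXnr// le_max lexx.
Qed.

End NowhereHolder.

(** * A nowhere Hölder function *)

Section LacunarySeries.
Variable R : realType.

Lemma cos_lipschitz (x y : R) : `|cos x - cos y| <= `|x - y|.
Proof.
wlog xy : x y / x <= y.
  by move=> H; have [/H//|/ltW /H] := leP x y; rewrite distrC (distrC y).
have cc : {within `[x, y], continuous (@cos R)}.
  by apply: continuous_subspaceT => z; exact: continuous_cos.
have [z _] := MVT_segment xy (fun z _ => is_derive_cos z) cc.
rewrite distrC (distrC x) => ->; rewrite normrM ler_piMl//.
by rewrite normrN sin_max.
Qed.

(** Two properties of these frequencies matter: the ratio of consecutive ones is
    at least 136, and [8 ^ n] is eventually negligible against every positive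
    power of [freq n]. *)
Definition freq (n : nat) : nat := 8 ^ (4 * n * n).

Definition wave (n : nat) (x : R) : R := cos (pi * (freq n)%:R * x) / 8 ^+ n.

Definition lacunary (x : R) : R := limn (series (wave ^~ x)).

Lemma freq_gt0 n : (0 < freq n)%N.
Proof. by rewrite expn_gt0. Qed.

Lemma freqS n : (136 * freq n <= freq n.+1)%N.
Proof.
rewrite /freq; have -> : (4 * n.+1 * n.+1 = (8 * n + 1) + 3 + 4 * n * n)%N by lia.
rewrite expnD leq_mul2r; apply/orP; right.
rewrite expnD; have : (0 < 8 ^ (8 * n + 0))%N by rewrite expn_gt0.
by rewrite addn0 addn1 expnS; lia.
Qed.

Lemma lacunary_tail n x :
  `|lacunary x - series (wave ^~ x) n| <= 2 * (8 ^+ n)^-1.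
Proof.
have H m j : `|wave (m + j) x| <= (8 ^+ m)^-1 / 2 ^+ j.
  rewrite /wave normrM normfV normrX (@ger0_norm _ 8)// exprD invfM.
  apply: le_trans (_ : 1 * ((8 ^+ m)^-1 / 8 ^+ j) <= _).
    by rewrite ler_wpM2r ?cos_max// mulr_ge0 ?invr_ge0 ?exprn_ge0.
  rewrite mul1r ler_wpM2l ?invr_ge0 ?exprn_ge0// lef_pV2 ?posrE ?exprn_gt0//.
  by rewrite lerXn2r ?nnegrE// ler_nat.
apply: series_tail_le (H n).
by apply: (@dominated_series_cvg _ _ ((8 ^+ 0)^-1)) => k; exact: (H 0%N).
Qed.

(** The terms below [n] are slow at the scale of the [n]-th: with
    |x - y| <= 1 / b_n they contribute at most a quarter of the amplitude 8^-n.
    The induction closes because (1/4 + 4) b_n <= b_(n+1) / 32, which is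
    where the constant 136 = 8 * 17 of [freqS] comes from. *)
Lemma partial_sum_lipschitz n x y :
  `|series (wave ^~ x) n - series (wave ^~ y) n| <=
    (freq n)%:R / 4 * `|x - y| / 8 ^+ n.
Proof.
elim: n => [|n IHn].
  by rewrite /series /= !big_nil subrr normr0 !mulr_ge0 ?invr_ge0.
have wn : `|wave n x - wave n y| <= 4 * (freq n)%:R * `|x - y| / 8 ^+ n.
  rewrite /wave -mulrBl normrM normfV (@ger0_norm _ (8 ^+ n)) ?exprn_ge0//.
  rewrite ler_wpM2r ?invr_ge0 ?exprn_ge0//.
  apply: le_trans (cos_lipschitz _ _) _; rewrite -mulrBr normrM.
  rewrite ler_wpM2r// normrM ger0_norm ?pi_ge0// ger0_norm// ler_wpM2r//.
  by have := pihalf_lt2 R; lra.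
rewrite /series /= !big_nat_recr //= opprD addrACA.
apply: le_trans (ler_normD _ _) _; apply: le_trans (lerD IHn wn) _.
rewrite -mulrDl exprS invfM mulrA ler_wpM2r ?invr_ge0 ?exprn_ge0//.
have : (136 * freq n)%:R <= (freq n.+1)%:R :> R by rewrite ler_nat freqS.
rewrite natrM; have := normr_ge0 (x - y).
move: (`|x - y|) => u; move: (freq n)%:R (freq n.+1)%:R => p q; nra.
Qed.

Lemma lacunary_continuous : continuous (lacunary \o @unit_val R).
Proof.
move=> x A /nbhs_ballP[e /= e0 eA].
have [n ne] : exists n : nat, 8 / e < n%:R.
  by exists (Num.truncn (8 / e)).+1; exact: truncnS_gt.
have f0 : 0 < (freq n)%:R :> R by rewrite ltr0n freq_gt0.
suff: nbhs x ((lacunary \o @unit_val R) @^-1` A) by [].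
apply/nbhs_ballP; exists (16 / (freq n)%:R) => /=; first by rewrite divr_gt0.
move=> y; rewrite unit_ball /= => xy; apply: eA; rewrite -ball_normE /=.
set X := unit_val x; set Y := unit_val y.
have h := lacunary_tail n X; have h' := lacunary_tail n Y.
have l := partial_sum_lipschitz n X Y.
have l2 : (freq n)%:R / 4 * `|X - Y| <= 4.
  by move: xy; rewrite -/X -/Y ltr_pdivlMr// => xy; lra.
have {}l : `|series (wave ^~ X) n - series (wave ^~ Y) n| <= 4 / 8 ^+ n.
  by apply: le_trans l _; rewrite ler_wpM2r ?invr_ge0.
have : 8 / 8 ^+ n < e.
  rewrite ltr_pdivrMr ?exprn_gt0// mulrC -ltr_pdivrMr//; apply: lt_trans ne _.
  by rewrite -natrX ltr_nat ltn_expl.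
move: h h' l; rewrite !ler_norml ltr_norml; move: (8 ^+ n)^-1 => q.
move: (lacunary X) (lacunary Y) (series _ _) (series _ _) => a b c d.
by move=> /andP[? ?] /andP[? ?] /andP[? ?] ?; apply/andP; split; lra.
Qed.

Lemma cos_pi_nat (k : nat) : `|cos (pi * k%:R)| = 1 :> R.
Proof.
elim: k => [|k IHk]; first by rewrite mulr0 cos0 normr1.
by rewrite -natr1 mulrDr mulr1 cosDpi normrN.
Qed.

(** The cosine takes the opposite values 1 and -1 at the two multiples of
    1 / b that surround [x]; its value at [x] differs by at least 1 from one of
    them. *)
Lemma cos_osc (b : nat) (x : R) : (0 < b)%N -> 0 <= x <= 1 ->
  exists y, [/\ 0 <= y <= 1, `|x - y| <= b%:R^-1 &
    1 <= `|cos (pi * b%:R * x) - cos (pi * b%:R * y)|].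
Proof.
move=> b0 /andP[x0 x1].
have bR : 0 < b%:R :> R by rewrite ltr0n.
have [k kb /andP[kx xk]] : exists2 k : nat, (k < b)%N & k%:R <= x * b%:R <= k.+1%:R.
  have [xlt|] := ltP x 1; last first.
    move=> x1'; have -> : x = 1 by apply/le_anti/andP.
    by exists b.-1; rewrite ?prednK// mul1r ler_nat leq_pred lexx.
  have xb : 0 <= x * b%:R by rewrite mulr_ge0// ltW.
  have /andP[kx xk] := truncn_itv xb.
  exists (Num.truncn (x * b%:R)); last by rewrite kx ltW.
  by rewrite -(ltr_nat R); apply: le_lt_trans kx _; rewrite gtr_pMl.
have pt (l : nat) : (k <= l <= k.+1)%N ->
    [/\ 0 <= (l%:R / b%:R : R) <= 1, `|x - l%:R / b%:R| <= b%:R^-1 &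
       cos (pi * b%:R * (l%:R / b%:R)) = cos (pi * l%:R) :> R].
  move=> /andP[kl lk]; split.
  - rewrite divr_ge0//= ler_pdivrMr// mul1r ler_nat.
    exact: leq_trans lk kb.
  - rewrite -[leRHS]mul1r ler_pdivlMr// -[X in _ * X]ger0_norm// -normrM mulrBl.
    rewrite divfK ?gt_eqF//.
    have : k%:R <= l%:R :> R by rewrite ler_nat.
    have : l%:R <= k.+1%:R :> R by rewrite ler_nat.
    by move: kx xk; rewrite -natr1 ler_norml => *; apply/andP; split; lra.
  - by rewrite -mulrA [b%:R * _]mulrC divfK ?gt_eqF.
have [y0 y1 y2] := pt k (introT andP (conj (leqnn k) (leqnSn k))).
have [z0 z1 z2] := pt k.+1 (introT andP (conj (leqnSn k) (leqnn k.+1))).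
set c := cos (pi * b%:R * x).
have [H|H] := leP 1 `|c - cos (pi * k%:R)|.
  by exists (k%:R / b%:R); split=> //; rewrite y2.
exists (k.+1%:R / b%:R); split=> //; rewrite z2 -natr1 mulrDr mulr1 cosDpi opprK.
have : `|2 * cos (pi * k%:R)| = 2 :> R by rewrite normrM cos_pi_nat mulr1 ger0_norm.
have -> : 2 * cos (pi * k%:R) = (c + cos (pi * k%:R)) - (c - cos (pi * k%:R)) by ring.
have := ler_normB (c + cos (pi * k%:R)) (c - cos (pi * k%:R)).
lra.
Qed.

(** Of the variation 8^-n of the [n]-th term, the earlier terms can cancel a
    quarter and the later ones a half. *)
Lemma lacunary_osc n (x : R) : 0 <= x <= 1 ->
  exists y, [/\ 0 <= y <= 1, `|x - y| <= (freq n)%:R^-1 &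
    (4 * 8 ^+ n)^-1 <= `|lacunary x - lacunary y|].
Proof.
move=> x01; have [y [y01 xy cxy]] := cos_osc (freq_gt0 n) x01.
exists y; split=> //.
have f0 : 0 < (freq n)%:R :> R by rewrite ltr0n freq_gt0.
have h := lacunary_tail n.+1 x; have h' := lacunary_tail n.+1 y.
have l := partial_sum_lipschitz n x y.
have l2 : (freq n)%:R / 4 * `|x - y| <= 1 / 4.
  by move: xy; rewrite -[leRHS]mul1r ler_pdivlMr// => xy; lra.
have {}l : `|series (wave ^~ x) n - series (wave ^~ y) n| <= 1 / 4 / 8 ^+ n.
  by apply: le_trans l _; rewrite ler_wpM2r ?invr_ge0.
have w : (8 ^+ n)^-1 <= `|wave n x - wave n y|.
  rewrite /wave -mulrBl normrM normfV (@ger0_norm _ (8 ^+ n))//.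
  by rewrite ler_peMl ?invr_ge0.
move: h h'; rewrite /series /= !big_nat_recr //= exprS !invfM.
move: l w; rewrite /series /=; move: (8 ^+ n)^-1 => q.
set A := \sum_(_ <= _ < _) _; set B := \sum_(_ <= _ < _) _.
set a := lacunary x; set b := lacunary y; set c := wave n x; set d := wave n y.
move=> l w h h'.
have e : c - d = (a - b) - (a - (A + c)) + (b - (B + d)) - (A - B) by ring.
have := ler_normB ((a - b) - (a - (A + c)) + (b - (B + d))) (A - B).
have := ler_normD ((a - b) - (a - (A + c))) (b - (B + d)).
have := ler_normB (a - b) (a - (A + c)).
rewrite -e; lra.
Qed.

Lemma lacunary_oscillating : wildly_oscillating (lacunary \o @unit_val R).
Proof.
move=> x alpha e M /andP[a0 a1] e0 M0.
have x01 : 0 <= unit_val x <= 1.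
  by have := set_valP x; rewrite /= in_itv.
have [n nP] : exists n : nat, 4 * M + e^-1 + alpha^-1 < n%:R.
  by exists (Num.truncn (4 * M + e^-1 + alpha^-1)).+1; exact: truncnS_gt.
have ei0 : 0 < e^-1 by rewrite invr_gt0.
have ai0 : 0 < alpha^-1 by rewrite invr_gt0.
have n0 : (0 < n)%N by rewrite -(ltr_nat R); lra.
have f0 : 0 < (freq n)%:R :> R by rewrite ltr0n freq_gt0.
have n8 : n%:R < 8 ^+ n :> R by rewrite -natrX ltr_nat ltn_expl.
have n8' : n%:R <= (freq n)%:R :> R.
  rewrite ler_nat /freq; apply: (@leq_trans (8 ^ n)); first by rewrite ltnW// ltn_expl.
  by rewrite leq_exp2l// leq_pmull// muln_gt0.
have [y [y01 xy Fxy]] := lacunary_osc n x01.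
have yI : y \in (`[0, 1]%classic : set R) by rewrite inE /= in_itv.
pose Y : unit_interval R := exist _ y yI.
have YE : unit_val Y = y by [].
exists Y; rewrite /= YE.
have q8 : 0 < 8 ^+ n :> R by rewrite exprn_gt0.
have xy0 : unit_val x != y.
  apply/eqP => xyE; move: Fxy; rewrite xyE subrr normr0 leNgt invr_gt0.
  by rewrite mulr_gt0.
split=> //.
  apply: le_lt_trans xy _; rewrite -[ltRHS]invrK ltf_pV2 ?posrE//.
  lra.
apply: le_trans Fxy; set u := `|_|.
have u0 : 0 < u by rewrite normr_gt0 subr_eq0.
(* Here [n * alpha >= 1] and [freq n] is the [n]-th power of [8 ^ (4 * n)]. *)
have fa : 8 ^+ (4 * n) <= (freq n)%:R `^ alpha :> R.
  have -> : (freq n)%:R = (8 ^+ (4 * n)) `^ n%:R :> R.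
    by rewrite powR_mulrn ?exprn_ge0// -exprM -natrX.
  rewrite -powRrM.
  rewrite -[leLHS]powRr1 ?exprn_ge0// ler_powR//.
    by rewrite exprn_ege1// ler1n.
  by rewrite -ler_pdivrMr// div1r; lra.
have ua : u `^ alpha <= (8 ^+ (4 * n))^-1.
  apply: (@le_trans _ _ ((freq n)%:R^-1 `^ alpha)).
    by apply: ge0_ler_powR; rewrite ?nnegrE ?invr_ge0 ?exprn_ge0// ltW.
  have -> : (freq n)%:R^-1 `^ alpha = ((freq n)%:R `^ alpha)^-1 :> R.
    by rewrite -[_^-1]powR_inv1 ?ltW// -powRrM mulN1r powRN.
  by rewrite lef_pV2 ?posrE ?powR_gt0// exprn_gt0.
apply: (@le_trans _ _ (M * (8 ^+ (4 * n))^-1)); first by rewrite ler_pM2l.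
have -> : (4 * n = n + n + (n + n))%N by rewrite !addnn -!mul2n mulnA.
rewrite !exprD ler_pdivrMr ?mulr_gt0// ler_pdivlMl ?mulr_gt0//.
have ge1 : 1 <= 8 ^+ n :> R by rewrite exprn_ege1// ler1n.
move: (8 ^+ n) q8 n8 ge1 => q q8 n8 ge1.
have q3 : q <= q * (q * q) by rewrite ler_peMr ?(ltW q8)// mulr_ege1.
have -> : 4 * q * M = q * (4 * M) by ring.
have -> : q * q * (q * q) = q * (q * (q * q)) by ring.
by rewrite ler_pM2l//; lra.
Qed.

End LacunarySeries.

(** * Polynomials in the generators *)

Section ExponentialFamily.
Variables (R : realType) (T : pointedType) (F : T -> R).

Definition exp_generator (s : nat -> bool) : T -> R :=
  fun x => expR (branch_real R s * F x).

Definition exponent (k : nat) (s : 'I_k -> nat -> bool) (m : multinom k) : R :=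
  \sum_i (m i)%:R * branch_real R (s i).

Lemma branch_real_inj : injective (@branch_real R).
Proof.
move=> s t e; apply: contrapT => st.
pose f (b : bool) := if b then s else t.
have fI : injective f by move=> [] [] //= E; case: st.
have := @branch_real_indep R bool f (fun b => if b then 1 else -1) fI.
by rewrite big_bool /= e mulN1r mul1r subrr => /(_ erefl true).
Qed.

Lemma exp_generator_inj : F != 0 -> injective exp_generator.
Proof.
move=> F0; have [x Fx] : exists x, F x != 0.
  apply: contrapT => H; case/eqP: F0; apply/funext => x.
  by apply/eqP/negPn/negP => Fx; apply: H; exists x.
move=> s t /(congr1 (@^~ x)) /expR_inj /(mulIf Fx); exact: branch_real_inj.
Qed.

Lemma exponent_inj k (s : 'I_k -> nat -> bool) :
  injective s -> injective (exponent s).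
Proof.
move=> sI m m' e; apply/mnmP => i.
have := @branch_real_indep R _ s (fun i => (m i)%:Z - (m' i)%:Z) sI _ i.
move=> H; have : (m i)%:Z - (m' i)%:Z = 0; last by lia.
apply: H; under eq_bigr do rewrite rmorphB /= mulrBl.
by rewrite sumrB; apply/eqP; rewrite subr_eq0; exact/eqP.
Qed.

Lemma exponent0 k (s : 'I_k -> nat -> bool) : exponent s (@mnm0 k) = 0.
Proof. by rewrite /exponent big1 // => i _; rewrite mnm0E mul0r. Qed.

(** Monomials in exponentials are again exponentials, so a polynomial in the
    generators is an exponential sum composed with [F]. *)
Lemma mpoly_eval_exp k (P : mpoly k R) (s : 'I_k -> nat -> bool) :
  mpoly_eval (fun i => exp_generator (s i)) P =
  (fun t => \sum_(m <- msupp P) mcoeff m P * expR (exponent s m * t)) \o F.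
Proof.
apply/funext => x; rewrite /mpoly_eval /mmap fct_sumE /=.
apply: eq_bigr => m _; rewrite /exponent mulr_suml expR_sum.
rewrite /mmap1.
have prodE (g : 'I_k -> T -> R) : (\prod_i g i) x = \prod_i g i x.
  by elim/big_rec2: _ => // i u v _ <-.
transitivity (mcoeff m P * (\prod_(i < k) exp_generator (s i) ^+ m i) x).
  have scE (c : R) (g : T -> R) : (c%:A * g) x = c * g x.
    by rewrite -scalerAl mul1r.
  exact: scE.
rewrite prodE; congr (_ * _); apply: eq_bigr => i _.
have powE (g : T -> R) n : (g ^+ n) x = g x ^+ n.
  by elim: n => // n IHn; rewrite !exprS -IHn.
by rewrite powE /exp_generator -expRM_natl -mulrA.
Qed.

End ExponentialFamily.

Theorem corollary4p8 (R : realType) :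
  @strongly_algebrable R (unit_interval R -> R) (nat -> bool) continuum
    (@nowhere_holder R).
Proof.
pose F : unit_interval R -> R := @lacunary R \o @unit_val R.
have cF : continuous F := @lacunary_continuous R.
have wF : wildly_oscillating F := @lacunary_oscillating R.
have gI : injective (exp_generator F).
  exact/exp_generator_inj/wildly_oscillating_neq0.
exists (range (exp_generator F)); split.
  by apply: inj_card_eq => s t _ _; exact: gI.
move=> k P y k0 P0 Pm yI yX.
have [s sE] : exists s : 'I_k -> nat -> bool, y = fun i => exp_generator F (s i).
  have : forall i, exists s, y i = exp_generator F s.
    by move=> i; have [s _ <-] := yX i; exists s.
  by move=> /choice[s sP]; exists s; apply/funext.
have sI : injective s by move=> i j e; apply: yI; rewrite sE e.
rewrite sE mpoly_eval_exp; set f := (fun t => _).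
have wfF : wildly_oscillating (f \o F).
  apply: wildly_oscillating_comp => // t.
  apply: exp_sum_local_growth => //.
  - by rewrite msupp_eq0.
  - by move=> m; rewrite mcoeff_msupp.
  - by move=> m m' _ _; exact: exponent_inj.
  - move=> m; rewrite mcoeff_msupp => mP; rewrite -(exponent0 R s).
    by apply: contraNneq mP => /(exponent_inj sI) ->; rewrite Pm.
split; first exact: wildly_oscillating_neq0.
apply: wildly_oscillating_nowhere_holder => //.
move=> x; apply: continuous_comp; first exact: cF.
exact: exp_sum_continuous.
Qed.
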